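(* Suppose the optimal value of the primal problem (P) is attained at some $\mathbf{y}^\star\in\bar{\mathcal{Y}}$ with $\mathbf{A}\mathbf{y}^\star=\mathbf{0}$. Let $\mathbf{y}\in\bar{\mathcal{Y}}$ and $\tilde{\mathbf{y}}=\frac1m(\mathbf{1}_{m\times m}\otimes\mathbf{I}_n)\,\mathbf{y}$. Then: 1. $\|\mathbf{y}-\mathbf{y}^\star\|\ge\|\tilde{\mathbf{y}}-\mathbf{y}^\star\|$. 2. $\tilde D\,\|\tilde{\mathbf{y}}-\mathbf{y}^\star\|\ge f(\tilde{\mathbf{y}})-f(\mathbf{y}^\star)$, where $$\tilde D=\sup_{\hat{\mathbf{y}}\in\bar{\mathcal{Y}},\ \mathbf{A}\hat{\mathbf{y}}=\mathbf{0}}\{\|\boldsymbol{\nu}\|\ :\ \boldsymbol{\nu}\in\partial f(\hat{\mathbf{y}})\}\in[0,\infty].$$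
   Context: Let $m\ge2$, $n\ge1$ be integers, $\mathcal{Y}\subseteq\mathbb{R}^n$ a closed convex set, and $f_i:\mathbb{R}^n\to\mathbb{R}$, $i=1,\dots,m$, strictly convex closed functions. For $\mathbf{y}=(\mathbf{y}_1,\dots,\mathbf{y}_m)\in(\mathbb{R}^n)^m=\mathbb{R}^{nm}$ put $f(\mathbf{y})=\sum_{i=1}^m f_i(\mathbf{y}_i)$, let $\bar{\mathcal{Y}}=\mathcal{Y}^m$, and $\mathbf{A}\mathbf{y}=(\mathbf{y}_1-\mathbf{y}_2,\dots,\mathbf{y}_{m-1}-\mathbf{y}_m)\in\mathbb{R}^{n(m-1)}$. Primal problem (P): minimize $f(\mathbf{y})$ subject to $\mathbf{y}\in\bar{\mathcal{Y}}$, $\mathbf{A}\mathbf{y}=\mathbf{0}$. $\partial f$ denotes the convex subdifferential, $\mathbf{1}_{m\times m}$ the all-ones matrix, $\otimes$ the Kronecker product (so every block of $\tilde{\mathbf{y}}$ is $\frac1m\sum_i\mathbf{y}_i$). Norms are Euclidean. The convention $\infty\cdot0=0$ is used if $\tilde D=\infty$. *)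

(* Defs.v *)
From mathcomp Require Import all_boot all_order all_algebra.
From mathcomp Require Import all_classical all_reals.
From mathcomp Require Import ereal topology normedtype convex.
From mathcomp Require Import mxtens.

Set Implicit Arguments.
Unset Strict Implicit.
Unset Printing Implicit Defensive.

Import Order.TTheory GRing.Theory Num.Theory.
Import numFieldNormedType.Exports.

Local Open Scope classical_set_scope.
Local Open Scope ring_scope.

Section Euclidean.
Variables (R : realType) (d : nat).
Implicit Types (u v x : 'cV[R]_d) (g : 'cV[R]_d -> R).

Definition dotv u v : R := \sum_(k < d) u k 0 * v k 0.

(* The library norm `|u| on matrices is the sup norm. *)
Definition enorm u : R := Num.sqrt (dotv u u).

Definition strictly_convex g : Prop :=
  forall x y (t : R), x != y -> 0 < t -> t < 1 ->
    g (t *: x + (1 - t) *: y) < t * g x + (1 - t) * g y.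

Definition epigraph g : set ('cV[R]_d * R) := [set p | g p.1 <= p.2].

Definition closed_function g : Prop := closed (epigraph g).

Definition subdifferential g x : set 'cV[R]_d :=
  [set nu | forall z, g x + dotv nu (z - x) <= g z].

End Euclidean.

(* A vector of (R^n)^m is a column of length m * n whose (i, j) entry sits at   *)
(* mxtens_index (i, j) = i * n + j, the layout used by the Kronecker product    *)
(* tensmx.                                                                      *)
Section Blocks.
Variables (R : realType) (m n : nat).

Definition vblock (y : 'cV[R]_(m * n)) (i : 'I_m) : 'cV[R]_n :=
  \col_j y (mxtens_index (i, j)) 0.

Definition vstack (b : 'I_m -> 'cV[R]_n) : 'cV[R]_(m * n) :=
  \col_k b (mxtens_unindex k).1 (mxtens_unindex k).2 0.

Definition block_power (Y : set 'cV[R]_n) : set 'cV[R]_(m * n) :=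
  [set y | forall i, Y (vblock y i)].

Definition separable_sum (f : 'I_m -> 'cV[R]_n -> R) (y : 'cV[R]_(m * n)) : R :=
  \sum_(i < m) f i (vblock y i).

Definition block_average (y : 'cV[R]_(m * n)) : 'cV[R]_(m * n) :=
  m%:R^-1 *: (tensmx (const_mx 1 : 'M[R]_m) (1%:M : 'M[R]_n) *m y).

End Blocks.

Lemma ord_next_proof m (i : 'I_m.-1) : (i.+1 < m)%N.
Proof. by rewrite -ltn_predRL. Qed.

Definition ord_cur m (i : 'I_m.-1) : 'I_m := widen_ord (leq_pred m) i.
Definition ord_next m (i : 'I_m.-1) : 'I_m := Ordinal (ord_next_proof i).

Definition consecutive_diff (R : realType) (m n : nat) (y : 'cV[R]_(m * n)) :
    'cV[R]_(m.-1 * n) :=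
  vstack (fun i => vblock y (ord_cur i) - vblock y (ord_next i)).

Section Problem.
Variables (R : realType) (m n : nat).
Variables (Y : set 'cV[R]_n) (f : 'I_m -> 'cV[R]_n -> R).

Definition feasible : set 'cV[R]_(m * n) :=
  [set y | block_power Y y /\ consecutive_diff y = 0].

Definition primal_optimal (ys : 'cV[R]_(m * n)) : Prop :=
  feasible ys /\
  forall z, feasible z -> separable_sum f ys <= separable_sum f z.

(* The supremum is taken in \bar R, where the empty supremum is -oo. *)
Definition Dtilde : \bar R :=
  ereal_sup [set (enorm nu)%:E | nu in
    \bigcup_(yh in feasible) subdifferential (separable_sum f) yh].

End Problem.

(* Main.v *)
Require Import Defs.
From mathcomp Require Import all_boot all_order all_algebra.
From mathcomp Require Import all_classical all_reals.
From mathcomp Require Import ereal topology normedtype convex.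
From mathcomp Require Import mxtens ring lra.

Import Order.TTheory GRing.Theory Num.Theory.
Import numFieldNormedType.Exports.

Local Open Scope classical_set_scope.
Local Open Scope ring_scope.

(** Averaging the blocks is the orthogonal projection onto the consensus
    subspace, which contains [ystar]; hence part 1.  The average is again
    feasible, and a finite convex function has a subgradient [nu] at every
    point, so that
    [f ytilde - f ystar <= <nu, ytilde - ystar> <= |nu| * |ytilde - ystar|]
    with [|nu| <= Dtilde].  The subgradient is built one coordinate at a time,
    as in the finite-dimensional Hahn-Banach theorem. *)

(** * One-step extension of a supporting slope for convex functions *)

Section ConvexFunction.
Context {R : realType} {V : lmodType R}.
Implicit Types (g : V -> R) (W : set V).

Definition is_convex g : Prop :=
  forall x y (t : R), 0 < t -> t < 1 ->
    g (t *: x + (1 - t) *: y) <= t * g x + (1 - t) * g y.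

(** The weight [p = t / (s + t)] cancels the [e] components, so the convex combination of
    [- s *: e + w1] and [t *: e + w2] falls in [W], where [g] is at least [g 0]. Convexity and
    clearing denominators do the rest. *)
Lemma is_convex_three_slopes {g W} {e w1 w2 : V} {s t : R} :
  is_convex g ->
  (forall x y (p : R), W x -> W y -> W (p *: x + (1 - p) *: y)) ->
  (forall w, W w -> g 0 <= g w) ->
  W w1 -> W w2 -> 0 < s -> 0 < t ->
  (g 0 - g (- s *: e + w1)) / s <= (g (t *: e + w2) - g 0) / t.
Proof.
move=> gconv Wconv gmin Ww1 Ww2 s0 t0.
have st0 : 0 < s + t by lra.
pose p := t / (s + t).
have p1 : 1 - p = s / (s + t) by rewrite /p; field; lra.
have p0 : 0 < p by rewrite divr_gt0.
have plt1 : p < 1 by rewrite -subr_gt0 p1 divr_gt0.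
have comb : p *: (- s *: e + w1) + (1 - p) *: (t *: e + w2)
          = p *: w1 + (1 - p) *: w2.
  rewrite !scalerDr !scalerA addrACA -scalerDl p1.
  rewrite (_ : p * - s + s / (s + t) * t = 0) ?scale0r ?add0r//.
  by rewrite /p; field; lra.
have := le_trans (gmin _ (Wconv _ _ p Ww1 Ww2)) _.
rewrite -comb => /(_ _ (gconv _ _ _ p0 plt1)).
set h1 := g (_ + w1); set h2 := g (_ + w2); set h0 := g 0; rewrite p1 => h.
have {h} : h0 * (s + t) <= t * h1 + s * h2.
  rewrite -ler_pdivlMr//; apply: (le_trans h).
  by rewrite /p le_eqVlt; apply/orP; left; apply/eqP; field; lra.
by move=> h; rewrite ler_pdivrMr// mulrAC ler_pdivlMr//; lra.
Qed.

(** The Hahn-Banach step: left slopes along [e] lie below right slopes, so some [a] separates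
    them. *)
Lemma is_convex_min_extend {g W} (e : V) :
  is_convex g -> W 0 ->
  (forall x y (p : R), W x -> W y -> W (p *: x + (1 - p) *: y)) ->
  (forall w, W w -> g 0 <= g w) ->
  exists a : R, forall t w, W w -> g 0 + a * t <= g (t *: e + w).
Proof.
move=> gconv W0 Wconv gmin.
(* [L] collects the left slopes; [a] is its supremum, finite because any right slope bounds [L]. *)
pose L := [set r : R | exists s w, [/\ 0 < s, W w &
                        r = (g 0 - g (- s *: e + w)) / s]].
have Lub t w : 0 < t -> W w -> ubound L ((g (t *: e + w) - g 0) / t).
  move=> t0 Ww _ [s [v [s0 Wv ->]]].
  exact: (is_convex_three_slopes gconv Wconv gmin).
have L0 : L !=set0 by exists ((g 0 - g (- 1 *: e + 0)) / 1); exists 1, 0.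
have supL : has_sup L.
  by split=> //; exists ((g (1 *: e + 0) - g 0) / 1); exact: Lub.
exists (sup L) => t w Ww; have [t0|t0|->] := ltgtP t 0.
(* For negative [t] the quotient is a left slope with [s = - t]. *)
- have : L ((g 0 - g (t *: e + w)) / - t).
    by exists (- t), w; rewrite opprK oppr_gt0.
  move/(sup_upper_bound supL); rewrite ler_pdivrMr ?oppr_gt0//; lra.
- have := ge_sup L0 (Lub _ _ t0 Ww).
  by rewrite ler_pdivlMr//; lra.
- by rewrite mulr0 addr0 scale0r add0r; exact: gmin.
Qed.

End ConvexFunction.

(** * Euclidean inner product and norm *)

Section Dotv.
Context {R : realType} {d : nat}.
Implicit Types u v w : 'cV[R]_d.

Lemma dotvC u v : dotv u v = dotv v u.
Proof. by apply: eq_bigr => k _; rewrite mulrC. Qed.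

Lemma dotvDl u v w : dotv (u + v) w = dotv u w + dotv v w.
Proof. by rewrite -big_split; apply: eq_bigr => k _; rewrite !mxE mulrDl. Qed.

Lemma dotvDr u v w : dotv w (u + v) = dotv w u + dotv w v.
Proof. by rewrite dotvC dotvDl !(dotvC w). Qed.

Lemma dotvZl (a : R) u v : dotv (a *: u) v = a * dotv u v.
Proof. by rewrite mulr_sumr; apply: eq_bigr => k _; rewrite mxE mulrA. Qed.

Lemma dotvZr (a : R) u v : dotv u (a *: v) = a * dotv u v.
Proof. by rewrite dotvC dotvZl dotvC. Qed.

Lemma dot0v v : dotv 0 v = 0.
Proof. by rewrite -(scale0r 0) dotvZl mul0r. Qed.

Lemma dotv0 v : dotv v 0 = 0.
Proof. by rewrite dotvC dot0v. Qed.

Lemma dotvNr u v : dotv u (- v) = - dotv u v.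
Proof. by rewrite -scaleN1r dotvZr mulN1r. Qed.

Lemma dotvBB u v : dotv (u - v) (u - v) = dotv u u - 2 * dotv u v + dotv v v.
Proof. by rewrite -scaleN1r !dotvDl !dotvDr !dotvZl !dotvZr (dotvC v u); ring. Qed.

Lemma dotv_suml I (r : seq I) (F : I -> 'cV[R]_d) v :
  dotv (\sum_(i <- r) F i) v = \sum_(i <- r) dotv (F i) v.
Proof.
by elim/big_rec2: _ => [|i x u _ <-]; rewrite ?dot0v ?dotvDl.
Qed.

Lemma dotvv_ge0 u : 0 <= dotv u u.
Proof. by apply: sumr_ge0 => k _; rewrite -expr2 sqr_ge0. Qed.

Lemma sqr_enorm u : enorm u ^+ 2 = dotv u u.
Proof. by rewrite sqr_sqrtr ?dotvv_ge0. Qed.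

Lemma enorm_ge0 u : 0 <= enorm u.
Proof. exact: sqrtr_ge0. Qed.

Lemma enorm_eq0 u : enorm u = 0 -> u = 0.
Proof.
move=> u0; have /psumr_eq0P uk0 : dotv u u = 0 by rewrite -sqr_enorm u0 expr0n.
apply/colP => k; rewrite mxE; apply/eqP; rewrite -sqrf_eq0 expr2.
by apply/eqP; apply: uk0 => // i _; rewrite -expr2 sqr_ge0.
Qed.

Lemma dotv_delta u k : dotv u (delta_mx k 0) = u k 0.
Proof.
rewrite /dotv (bigD1 k)//= big1 ?addr0 ?mxE ?eqxx ?mulr1//.
by move=> i ik; rewrite mxE (negbTE ik) mulr0.
Qed.

(** Cauchy-Schwarz: with [a], [b] the norms of [u], [v], the squared norm of [b *: u - a *: v] is
    [2ab(ab - dotv u v)], and [ab] can be cancelled once it is positive. *)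
Lemma dotv_le_enorm u v : dotv u v <= enorm u * enorm v.
Proof.
have [u0|u0] := eqVneq (enorm u) 0.
  by rewrite (enorm_eq0 _ u0) dot0v mulr_ge0 ?enorm_ge0.
have [v0|v0] := eqVneq (enorm v) 0.
  by rewrite (enorm_eq0 _ v0) dotv0 mulr_ge0 ?enorm_ge0.
have up : 0 < enorm u by rewrite lt_def u0 enorm_ge0.
have vp : 0 < enorm v by rewrite lt_def v0 enorm_ge0.
have := dotvv_ge0 (enorm v *: u - enorm u *: v).
rewrite dotvBB !dotvZl !dotvZr -!sqr_enorm => h.
rewrite -subr_ge0 -(pmulr_rge0 _ (mulr_gt0 up vp)).
by move: h; set a := enorm u; set b := enorm v => h; nra.
Qed.

(** The sum of the squared distances from [b i] to the mean [c] equals the right side minus the left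
    side. *)
Lemma sum_dotv_mean_le m (b : 'I_m -> 'cV[R]_d) c : (0 < m)%N ->
  c = m%:R^-1 *: \sum_i b i ->
  \sum_(i < m) dotv c c <= \sum_i dotv (b i) (b i).
Proof.
move=> m0 cE.
have mR : (m%:R : R) != 0 by rewrite pnatr_eq0 -lt0n.
have bc : \sum_i dotv (b i) c = m%:R * dotv c c.
  by rewrite -dotv_suml {2}cE dotvZl mulrA mulfV// mul1r.
have : 0 <= \sum_i dotv (b i - c) (b i - c).
  by apply: sumr_ge0 => i _; exact: dotvv_ge0.
under eq_bigr do rewrite dotvBB.
rewrite big_split sumrB -mulr_sumr bc /= sumr_const card_ord -mulr_natl; lra.
Qed.

End Dotv.

(** * Existence of subgradients *)

Section Subgradient.
Context {R : realType} {d : nat}.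
Implicit Types g : 'cV[R]_d -> R.

(** Induction on the number [k] of coordinates allowed to be nonzero; each step fixes one more
    coordinate of [nu]. *)
Lemma is_convex_subgradient_partial g k : is_convex g -> (k <= d)%N ->
  exists nu : 'cV[R]_d, forall z : 'cV[R]_d,
    (forall j : 'I_d, (k <= j)%N -> z j 0 = 0) -> g 0 + dotv nu z <= g z.
Proof.
move=> gconv; elim: k => [_|k IH kd].
  exists 0 => z z0; have -> : z = 0 by apply/colP => j; rewrite z0// mxE.
  by rewrite dot0v addr0.
have [nu nuP] := IH (ltnW kd).
pose e : 'cV[R]_d := delta_mx (Ordinal kd) 0.
pose W := [set z : 'cV[R]_d | forall j : 'I_d, (k <= j)%N -> z j 0 = 0].
(* Subtracting the linear form already found turns the induction hypothesis into minimality of [h]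
   at 0 on [W]. *)
pose h z := g z - dotv nu z.
have h0 : h 0 = g 0 by rewrite /h dotv0 subr0.
have hconv : is_convex h.
  move=> x y t t0 t1; rewrite /h dotvDr !dotvZr.
  by have := gconv x y t t0 t1; lra.
have [||w Ww|a aP] := @is_convex_min_extend _ _ h W e hconv.
- by move=> j _; rewrite mxE.
- by move=> x y p Wx Wy j kj; rewrite !mxE Wx// Wy// !mulr0 addr0.
- by rewrite h0 /h lerBrDr; exact: nuP.
exists (nu + a *: e) => z z0.
pose t := z (Ordinal kd) 0.
have Ww : W (z - t *: e).
  move=> j; rewrite leq_eqVlt => /predU1P[kj|kj].
    rewrite /t (_ : j = Ordinal kd) ?mxE ?eqxx ?mulr1 ?subrr//.
    exact: val_inj.
  by rewrite !mxE z0// -val_eqE/= gtn_eqF// mulr0 subr0.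
have := aP t _ Ww; rewrite (addrC (t *: e)) h0 subrK /h.
by rewrite dotvDl dotvZl dotvC (dotvC e) dotv_delta -/t dotvC; lra.
Qed.

Lemma is_convex_subdifferential g x : is_convex g -> subdifferential g x !=set0.
Proof.
move=> gconv.
(* Translate [x] to the origin; for [k = d] the coordinate condition is vacuous. *)
have [||nu nuP] := @is_convex_subgradient_partial (fun z => g (x + z)) d.
- move=> u v t t0 t1; rewrite (_ : x + _ = t *: (x + u) + (1 - t) *: (x + v)).
    exact: gconv.
  by rewrite !scalerDr addrACA -scalerDl (addrC t) subrK scale1r.
- by [].
exists nu => z; have := nuP (z - x).
rewrite addr0 (addrC x) subrK; apply => j.
by rewrite leqNgt ltn_ord.
Qed.

End Subgradient.

(** * Convexity and means *)

Section Averages.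
Context {R : realType}.

Lemma strictly_convex_is_convex {d} (g : 'cV[R]_d -> R) :
  strictly_convex g -> is_convex g.
Proof.
move=> gconv x y t t0 t1; have [->|xy] := eqVneq x y; last exact/ltW/gconv.
by rewrite -scalerDl -mulrDl (addrC t) subrK scale1r mul1r.
Qed.

Lemma convex_set_mean (V : lmodType R) (A : set V) m (b : 'I_m -> V) :
  convex_set A -> (0 < m)%N -> (forall i, A (b i)) -> A (m%:R^-1 *: \sum_i b i).
Proof.
move=> Aconv; case: m b => // k b _.
elim: k b => [|k IH] b Ab; first by rewrite big_ord1 invr1 scale1r.
have tk0 : 0 <= k.+1%:R / k.+2%:R :> R by rewrite divr_ge0.
have tk1 : k.+1%:R / k.+2%:R <= 1 :> R by rewrite ler_pdivrMr// mul1r ler_nat.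
pose c := k.+1%:R^-1 *: \sum_(i < k.+1) b (widen_ord (leqnSn _) i).
(* The mean of [k.+2] points is a convex combination of the mean of the first [k.+1] and the last
   point. *)
have -> : k.+2%:R^-1 *: \sum_i b i =
    (k.+1%:R / k.+2%:R) *: c + (1 - k.+1%:R / k.+2%:R) *: b ord_max.
  have p0 : (k.+1%:R : R) != 0 by rewrite pnatr_eq0.
  have q0 : (k.+2%:R : R) != 0 by rewrite pnatr_eq0.
  rewrite big_ord_recr/= scalerDr scalerA mulrAC mulfV// mul1r.
  by congr (_ + _ *: _); rewrite -[X in X - _](mulfV q0) -mulrBl -natrB// subSnn mul1r.
have Ac : A c by apply: IH => i; exact: Ab.
exact: set_mem (Aconv _ _ (Itv01 tk0 tk1) (mem_set Ac) (mem_set (Ab ord_max))).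
Qed.

End Averages.

(** * Block structure and the consensus subspace *)

Section Blocks.
Context {R : realType} {m n : nat}.
Implicit Types u v y : 'cV[R]_(m * n).

Lemma sum_mxtens_index (F : 'I_(m * n) -> R) :
  \sum_k F k = \sum_i \sum_j F (mxtens_index (i, j)).
Proof.
rewrite pair_big/=; under [RHS]eq_bigr do rewrite -surjective_pairing.
apply: reindex; exists (@mxtens_unindex m n) => k _.
- exact: mxtens_indexK.
- exact: mxtens_unindexK.
Qed.

Lemma dotv_vblock u v : dotv u v = \sum_i dotv (vblock u i) (vblock v i).
Proof.
rewrite /dotv sum_mxtens_index; apply: eq_bigr => i _; apply: eq_bigr => j _.
by rewrite !mxE.
Qed.

Lemma vblockB u v i : vblock (u - v) i = vblock u i - vblock v i.
Proof. by apply/colP => j; rewrite !mxE. Qed.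

Lemma vblock_average y i :
  vblock (block_average y) i = m%:R^-1 *: \sum_k vblock y k.
Proof.
apply/colP => j; rewrite !mxE sum_mxtens_index summxE; congr (_ * _).
(* In the row of index [(i, j)] the Kronecker matrix has entry 1 at each [(k, j)] and 0
   elsewhere. *)
apply: eq_bigr => k _; rewrite mxE (bigD1 j)//= tensmxE !mxE eqxx mulr1 mul1r.
rewrite big1 ?addr0// => l lj.
by rewrite tensmxE !mxE eq_sym (negbTE lj) mulr0 mul0r.
Qed.

Lemma consecutive_diff_eq0 y : consecutive_diff y = 0 <->
  forall i j, vblock y i = vblock y j.
Proof.
split=> [y0|yE]; last first.
  by apply/colP => k; rewrite mxE (yE _ (ord_next (mxtens_unindex k).1)) subrr !mxE.
have step (i : 'I_m.-1) : vblock y (ord_cur i) = vblock y (ord_next i).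
  apply/eqP; rewrite -subr_eq0; apply/eqP/colP => j.
  have /colP/(_ (mxtens_index (i, j))) := y0.
  by rewrite mxE mxtens_indexK /= !mxE.
(* Chaining consecutive equalities identifies every block with block 0. *)
have all0 k (km : (k < m)%N) (m0 : (0 < m)%N) :
    vblock y (Ordinal km) = vblock y (Ordinal m0).
  elim: k km => [|k IH] km; first by congr vblock; apply: val_inj.
  have km1 : (k < m.-1)%N by rewrite ltn_predRL.
  rewrite -(IH (ltnW km)).
  rewrite (_ : Ordinal km = ord_next (Ordinal km1)); last exact: val_inj.
  by rewrite -step; congr vblock; apply: val_inj.
move=> [i im] [j jm]; have m0 := leq_ltn_trans (leq0n i) im.
by rewrite (all0 _ im m0) (all0 _ jm m0).
Qed.

(** All blocks of [v] agree, so each block of [block_average y - v] is the mean of the blocks of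
    [y - v]. *)
Lemma enorm_block_average_le y v : (0 < m)%N -> consecutive_diff v = 0 ->
  enorm (block_average y - v) <= enorm (y - v).
Proof.
move=> m0 /consecutive_diff_eq0 vE; rewrite ler_wsqrtr// !dotv_vblock.
have := sum_dotv_mean_le m (vblock (y - v)) _ m0 erefl; congr (_ <= _).
have mR : (m%:R : R) != 0 by rewrite pnatr_eq0 -lt0n.
apply: eq_bigr => i _.
rewrite vblockB vblock_average; under eq_bigr do rewrite vblockB (vE _ i).
rewrite sumrB sumr_const card_ord -[vblock v i *+ m]scaler_nat scalerBr scalerA mulVf//.
by rewrite scale1r.
Qed.

Lemma feasible_block_average (Y : set 'cV[R]_n) y : (0 < m)%N ->
  convex_set Y -> block_power Y y -> feasible Y (block_average y).
Proof.
move=> m0 Yconv Yy; split=> [i|].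
  by rewrite vblock_average; exact: convex_set_mean.
by apply/consecutive_diff_eq0 => i j; rewrite !vblock_average.
Qed.

Lemma is_convex_separable_sum (f : 'I_m -> 'cV[R]_n -> R) :
  (forall i, is_convex (f i)) -> is_convex (separable_sum f).
Proof.
move=> fconv x y t t0 t1; rewrite !mulr_sumr -big_split; apply: ler_sum => i _.
rewrite (_ : vblock _ i = t *: vblock x i + (1 - t) *: vblock y i).
  exact: fconv.
by apply/colP => j; rewrite !mxE.
Qed.

End Blocks.

Theorem lemma4 (R : realType) (m n : nat) (hm : (2 <= m)%N) (hn : (1 <= n)%N)
  (Y : set 'cV[R]_n) (Yclosed : closed Y) (Yconvex : convex_set Y)
  (f : 'I_m -> 'cV[R]_n -> R)
  (fconvex : forall i, strictly_convex (f i))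
  (fclosed : forall i, closed_function (f i))
  (ystar : 'cV[R]_(m * n)) (ystar_opt : primal_optimal Y f ystar)
  (y : 'cV[R]_(m * n)) (hy : block_power Y y) :
  enorm (block_average y - ystar) <= enorm (y - ystar) /\
  (0 <= Dtilde Y f)%E /\
  ((separable_sum f (block_average y) - separable_sum f ystar)%:E
     <= Dtilde Y f * (enorm (block_average y - ystar))%:E)%E.
Proof.
have m0 : (0 < m)%N := ltnW hm.
have [[_ ystar_cons] _] := ystar_opt.
have [nu nuP] : subdifferential (separable_sum f) (block_average y) !=set0.
  apply: is_convex_subdifferential; apply: is_convex_separable_sum => i.
  exact: strictly_convex_is_convex.
have nuD : ((enorm nu)%:E <= Dtilde Y f)%E.
  apply: ereal_sup_ubound; exists nu => //; exists (block_average y) => //.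
  exact: feasible_block_average.
split; first exact: enorm_block_average_le.
(* The subgradient [nu] keeps the supremum away from the empty value [-oo]. *)
split; first by apply: le_trans nuD; rewrite lee_fin enorm_ge0.
apply: (@le_trans _ _ ((enorm nu)%:E * (enorm (block_average y - ystar))%:E)%E).
  rewrite -EFinM lee_fin; apply: le_trans (dotv_le_enorm _ _).
  (* The subgradient inequality at the average, tested at [ystar], with the sign of the difference
     reversed. *)
  by have := nuP ystar; rewrite -opprB dotvNr; lra.
(* Monotonicity in the first factor also covers [Dtilde Y f] infinite. *)
by rewrite lee_wpmul2r// lee_fin enorm_ge0.
Qed.
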